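(* There is a planar graph $G$ with $\operatorname{pn}_\ell(G) = 3$.
   Context: All graphs are finite and simple. A linear embedding of a graph $G=(V,E)$ is a pair $(\prec,\mathcal{P})$ where $\prec$ is a total ordering of $V$ and $\mathcal{P}$ is a partition of $E$ into parts called pages. Two edges $uv, xy$ with $u\prec v$, $x \prec y$ cross if $u \prec x \prec v \prec y$ or $x \prec u \prec y \prec v$. A book embedding is a linear embedding in which no two crossing edges lie on the same page. For a book embedding and a vertex $v$, let $\mathcal{P}_v$ be the set of pages containing at least one edge incident to $v$; the embedding is $k$-local if $|\mathcal{P}_v| \le k$ for all vertices $v$. The local page number $\operatorname{pn}_\ell(G)$ is the smallest $k$ such that $G$ admits a $k$-local book embedding (with any number of pages). *)

(* Defs.v *)
From Stdlib Require Import Reals.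
From mathcomp Require Import all_boot.

Set Implicit Arguments.
Unset Strict Implicit.
Unset Printing Implicit Defensive.

Definition simple_graph (T : finType) (e : rel T) : Prop :=
  symmetric e /\ irreflexive e.

(* The total order on V is given by an injective position map pos : T -> nat
   (u ≺ v iff pos u < pos v).  The partition of E into pages is given by a
   page label pg u v (a nat) attached to every edge, symmetric in u v;
   the pages are the nonempty label classes. *)
Definition lo (T : finType) (pos : T -> nat) (u v : T) := minn (pos u) (pos v).
Definition hi (T : finType) (pos : T -> nat) (u v : T) := maxn (pos u) (pos v).

Definition cross (T : finType) (pos : T -> nat) (u v x y : T) : bool :=
  ((lo pos u v < lo pos x y) && (lo pos x y < hi pos u v) && (hi pos u v < hi pos x y))
  || ((lo pos x y < lo pos u v) && (lo pos u v < hi pos x y) && (hi pos x y < hi pos u v)).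

Definition book_embedding (T : finType) (e : rel T)
    (pos : T -> nat) (pg : T -> T -> nat) : Prop :=
  injective pos /\
  (forall u v, e u v -> pg u v = pg v u) /\
  (forall u v x y, e u v -> e x y -> pg u v = pg x y -> ~~ cross pos u v x y).

Definition pages_at (T : finType) (e : rel T) (pg : T -> T -> nat) (v : T) : seq nat :=
  undup [seq pg v w | w <- enum T & e v w].

Definition k_local_book_embedding (T : finType) (e : rel T) (k : nat) : Prop :=
  exists (pos : T -> nat) (pg : T -> T -> nat),
    book_embedding e pos pg /\ forall v, size (pages_at e pg v) <= k.

Definition local_page_number_is (T : finType) (e : rel T) (k : nat) : Prop :=
  k_local_book_embedding e k /\ forall j, j < k -> ~ k_local_book_embedding e j.

Local Open Scope R_scope.

Definition in01 (t : R) : Prop := 0 <= t <= 1.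

Definition cont01 (f : R -> R * R) : Prop :=
  forall t, in01 t -> forall eps, 0 < eps -> exists d, 0 < d /\
    forall s, in01 s -> Rabs (s - t) < d ->
      Rabs (fst (f s) - fst (f t)) < eps /\ Rabs (snd (f s) - snd (f t)) < eps.

Definition planar (T : finType) (e : rel T) : Prop :=
  exists (pt : T -> R * R) (arc : T -> T -> R -> R * R),
    injective pt /\
    (forall u v, e u v ->
       cont01 (arc u v) /\ arc u v 0 = pt u /\ arc u v 1 = pt v /\
       (forall s t, in01 s -> in01 t -> arc u v s = arc u v t -> s = t) /\
       (forall t w, 0 < t < 1 -> arc u v t <> pt w)) /\
    (forall u v x y, e u v -> e x y ->
       [set u; v] != [set x; y] ->
       forall s t, 0 < s < 1 -> 0 < t < 1 -> arc u v s <> arc x y t).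

(* Main.v *)
Require Import Defs.
From Stdlib Require Import Reals.
From mathcomp Require Import all_boot.
From Stdlib Require Import ZArith Lra.
From mathcomp Require Import zify.

(* In a 2-local book embedding every K4 has an edge uv such that all edges at u and v lie on two
   pages A and B: otherwise the page sets of its four vertices are distinct pairs that meet, hence
   they share one page (four pairs do not fit into three elements), and that page carries the
   whole K4, which is not outerplanar. So we take a K4 and attach to each of its edges uv seven
   units: two adjacent common neighbours s, t of u and v, a vertex z adjacent to u, s, t and a
   vertex y adjacent to v, s, t. No page contains K_{2,3}, so at most four units have an s or t
   with both edges to u, v on the same page; in the other three, all edges at s and t lie on A and
   B. Among such common neighbours x on the same side of uv in the cyclic order, all ux lie on one
   page and all vx on the other. If s, t of one unit are on the same side and there is a third
   such x on that side, then z and y must lie between s and t, and st crosses uz or vy. If s and t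
   are always on opposite sides, then the middle one of three on the same side cannot leave it. In
   a 3-local embedding each hub uses its own page for its star and one page serves the units. *)

Set Implicit Arguments.
Unset Strict Implicit.
Unset Printing Implicit Defensive.

(** * Crossings and cyclic order *)

Lemma crossCl (T : finType) (p : T -> nat) u v a b : cross p u v a b = cross p v u a b.
Proof. by rewrite /cross /lo /hi minnC maxnC. Qed.

Lemma crossCr (T : finType) (p : T -> nat) u v a b : cross p u v a b = cross p u v b a.
Proof. by rewrite /cross /lo /hi (minnC (p a)) (maxnC (p a)). Qed.

Lemma cross_sorted (T : finType) (p : T -> nat) u v a b :
    p u <= p v -> p a <= p b ->
  cross p u v a b = (p u < p a < p v) && (p v < p b) || (p a < p u < p b) && (p b < p v).
Proof. by move=> uv ab; rewrite /cross /lo /hi !(minn_idPl _) ?(maxn_idPr _). Qed.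

Definition inside (T : finType) (p : T -> nat) (u v x : T) :=
  lo p u v < p x < hi p u v.

Lemma insideC (T : finType) (p : T -> nat) u v x : inside p u v x = inside p v u x.
Proof. by rewrite /inside /lo /hi minnC maxnC. Qed.

(** On a circle two chords cross exactly when one separates the ends of the other. A shared end
    would count as not [inside], so the hypotheses exclude it. *)
Lemma cross_inside (T : finType) (p : T -> nat) u v a b :
    p a != p u -> p a != p v -> p b != p u -> p b != p v ->
  cross p u v a b = (inside p u v a != inside p u v b).
Proof.
wlog uv : u v / p u <= p v => [th|].
  case/orP: (leq_total (p u) (p v)) => h; first exact: th.
  by move=> *; rewrite crossCl insideC (insideC _ u v b) th.
wlog ab : a b / p a <= p b => [th|].
  case/orP: (leq_total (p a) (p b)) => h; first exact: th.
  by move=> *; rewrite crossCr th // eq_sym.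
rewrite (cross_sorted uv ab) /inside /lo /hi (minn_idPl uv) (maxn_idPr uv).
move: (p u) (p v) (p a) (p b) uv ab => i j k l.
case: (ltngtP i k); case: (ltngtP k j); case: (ltngtP i l); case: (ltngtP l j) => /=; lia.
Qed.

(** Of the three ways to pair four points on a circle, the one joining opposite points crosses. *)
Lemma cross_one_pairing (T : finType) (p : T -> nat) u v a b :
    uniq [seq p x | x <- [:: u; v; a; b]] ->
  [|| cross p u v a b, cross p u a v b | cross p u b v a].
Proof.
rewrite /= !inE => h.
rewrite !cross_inside; try lia.
rewrite /inside /lo /hi /minn /maxn.
move: (p u) (p v) (p a) (p b) h => i j k l h.
case: (ltngtP i j); case: (ltngtP i k); case: (ltngtP i l) => //=;
  case: (ltngtP k j) => //=; case: (ltngtP l j) => //=; case: (ltngtP k l) => //=; lia.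
Qed.

(** Crossings depend only on the cyclic order up to reflection, so the side of [uv] that contains
    [s] can be turned into the interval between [u] and [v]. *)
Lemma rotate_book (T : finType) (e : rel T) (p : T -> nat) pg (u v s : T) :
    book_embedding e p pg -> u != v -> s != u -> s != v ->
  exists q : T -> nat,
    [/\ book_embedding e q pg, forall a b c d, cross q a b c d = cross p a b c d,
        forall x, x != u -> q u < q x & q s < q v].
Proof.
move=> [injp [pgC nX]] uv su sv.
suff [q [injq qX qu qs]] : exists q : T -> nat,
    [/\ injective q, forall a b c d, cross q a b c d = cross p a b c d,
        forall x, x != u -> q u < q x & q s < q v].
  by exists q; split=> //; split=> //; split=> // *; rewrite qX; apply: nX.
pose M := (\max_x p x).+1.
have ltM x : p x < M by rewrite ltnS; apply: (@leq_bigmax T p).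
(* [q1] rotates [u] to the front; if needed, [q2] then reverses the order of the others. *)
pose q1 x := if p x < p u then p x + M else p x.
have injq1 : injective q1.
  move=> x y h; apply: injp; move: h; rewrite /q1.
  have := ltM x; have := ltM y; case: (ltnP (p x) (p u)); case: (ltnP (p y) (p u)); lia.
have q1X a b c d : cross q1 a b c d = cross p a b c d.
  wlog ab : a b / p a <= p b => [th|].
    case/orP: (leq_total (p a) (p b)) => h; first exact: th.
    by rewrite crossCl th // crossCl.
  wlog cd : c d / p c <= p d => [th|].
    case/orP: (leq_total (p c) (p d)) => h; first exact: th.
    by rewrite crossCr th // crossCr.
  rewrite (cross_sorted ab cd).
  (* A pair changes its order only if exactly one of its members precedes [u]. *)
  have q1E x y : p x <= p y ->
      q1 x <= q1 y /\ ((p u <= p x) || (p y < p u)) \/ q1 y <= q1 x /\ (p x < p u <= p y).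
    by have := ltM y; rewrite /q1; case: (ltnP (p x) (p u)); case: (ltnP (p y) (p u)); lia.
  have := (ltM a, ltM b, ltM c, ltM d) => -[[[ha hb] hc] hd].
  case: (q1E a b ab) => -[qab hab]; case: (q1E c d cd) => -[qcd hcd];
    [|rewrite crossCr|rewrite crossCl|rewrite crossCl crossCr]; rewrite cross_sorted // /q1;
  move: (p a) (p b) (p c) (p d) (p u) ab cd ha hb hc hd hab hcd {qab qcd} => i j k l m *.
  - case: (ltnP i m); case: (ltnP j m); case: (ltnP k m); case: (ltnP l m); lia.
  - case: (ltnP i m); case: (ltnP j m); case: (ltnP k m); case: (ltnP l m); lia.
  - case: (ltnP i m); case: (ltnP j m); case: (ltnP k m); case: (ltnP l m); lia.
  - case: (ltnP i m); case: (ltnP j m); case: (ltnP k m); case: (ltnP l m); lia.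
have q1u x : x != u -> q1 u < q1 x.
  rewrite -(eqtype.inj_eq injp) /q1 ltnn; have := ltM u; case: (ltnP (p x) (p u)); lia.
case: (ltnP (q1 s) (q1 v)) => h; first by exists q1; split.
have {}h : q1 v < q1 s by rewrite ltn_neqAle h andbT (eqtype.inj_eq injq1) eq_sym.
(* The subtraction in [q2] is truncated; this bound keeps it exact and positive. *)
have lt2M x : q1 x < M + M.
  by rewrite /q1; have := ltM x; case: (ltnP (p x) (p u)); lia.
have leu x : q1 u <= q1 x by case: (eqVneq x u) => [->//|/q1u/ltnW].
pose q2 x := if q1 x <= q1 u then 0 else M + M - q1 x.
have injq2 : injective q2.
  move=> x y hxy; apply: injq1; move: hxy; rewrite /q2.
  have := (leu x, leu y, lt2M x, lt2M y) => -[[[? ?] ?] ?].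
  case: (leqP (q1 x) (q1 u)); case: (leqP (q1 y) (q1 u)); lia.
exists q2; split=> //; last first.
- by rewrite /q2; have := lt2M s; case: (leqP (q1 s) (q1 u)); case: (leqP (q1 v) (q1 u));
    have := q1u v; rewrite eq_sym uv; lia.
- by move=> x /q1u; rewrite /q2 leqnn; have := lt2M x; case: (leqP (q1 x) (q1 u)); lia.
move=> a b c d; rewrite -q1X.
wlog ab : a b / q1 a <= q1 b => [th|].
  case/orP: (leq_total (q1 a) (q1 b)) => hab; first exact: th.
  by rewrite crossCl th // crossCl.
wlog cd : c d / q1 c <= q1 d => [th|].
  case/orP: (leq_total (q1 c) (q1 d)) => hcd; first exact: th.
  by rewrite crossCr th // crossCr.
rewrite (cross_sorted ab cd).
have q2E x y : q1 x <= q1 y ->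
    q2 x <= q2 y /\ (q1 x <= q1 u) \/ q2 y <= q2 x /\ (q1 u < q1 x).
  by rewrite /q2; have := lt2M y;
    case: (leqP (q1 x) (q1 u)); case: (leqP (q1 y) (q1 u)); lia.
have := (lt2M a, lt2M b, lt2M c, lt2M d) => -[[[ha hb] hc] hd].
have := (leu a, leu b, leu c, leu d) => -[[[ka kb] kc] kd].
case: (q2E a b ab) => -[qab hab]; case: (q2E c d cd) => -[qcd hcd];
  [|rewrite crossCr|rewrite crossCl|rewrite crossCl crossCr]; rewrite cross_sorted // /q2;
move: (q1 a) (q1 b) (q1 c) (q1 d) (q1 u) ab cd ha hb hc hd ka kb kc kd hab hcd {qab qcd}
  => i j k l m *.
- case: (leqP i m); case: (leqP j m); case: (leqP k m); case: (leqP l m); lia.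
- case: (leqP i m); case: (leqP j m); case: (leqP k m); case: (leqP l m); lia.
- case: (leqP i m); case: (leqP j m); case: (leqP k m); case: (leqP l m); lia.
- case: (leqP i m); case: (leqP j m); case: (leqP k m); case: (leqP l m); lia.
Qed.

(** * Units on an edge whose ends use two pages *)

Definition pages_within (T : finType) (e : rel T) (pg : T -> T -> nat) A B x :=
  forall w, e x w -> pg x w = A \/ pg x w = B.

(* [z] and [y] are the vertices stacked into the triangles [ust] and [vst]. *)
Definition unit_gadget (T : eqType) (e : rel T) (u v s t z y : T) : bool :=
  [&& e u s, e v s, e u t, e v t & e s t] && [&& e u z, e s z, e t z & z != v]
  && [&& e v y, e s y, e t y & y != u].

Lemma unit_gadgetC (T : finType) (e : rel T) (u v s t z y : T) :
  symmetric e -> unit_gadget e u v s t z y = unit_gadget e u v t s z y.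
Proof.
move=> esym; rewrite /unit_gadget (esym t s).
by do ![case: (e _ _) => //=].
Qed.

Lemma adj_neq (T : finType) (e : rel T) x y : irreflexive e -> e x y -> x != y.
Proof. by move=> eirr; apply: contraTneq => ->; rewrite eirr. Qed.

Lemma cross_lt (T : finType) (q : T -> nat) a b c d :
  q a < q c -> q c < q b -> q b < q d -> cross q a b c d.
Proof.
move=> ac cb bd; rewrite cross_sorted; first by rewrite ac cb bd.
  exact: ltnW (ltn_trans ac cb).
exact: ltnW (ltn_trans cb bd).
Qed.

Lemma page_neq (T : finType) (e : rel T) pg q (a b c d : T) :
  book_embedding e q pg -> e a b -> e c d -> cross q a b c d -> pg a b <> pg c d.
Proof. by move=> [_ [_ nX]] ab cd + h; rewrite (negPf (nX _ _ _ _ ab cd h)). Qed.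

(* Here and in the next lemma [u] comes first in [q], so the vertices before [v] are
   those on one side of [uv]. *)
Lemma same_side_pattern (T : finType) (e : rel T) pg q A B (u v s t : T) :
    book_embedding e q pg -> irreflexive e -> (forall x, x != u -> q u < q x) ->
    pages_within e pg A B u -> pages_within e pg A B v ->
    e u s -> e v s -> e u t -> e v t -> pg u s <> pg v s -> pg u t <> pg v t ->
    s != t -> q s < q v -> q t < q v -> pg u s = pg u t /\ pg v s = pg v t.
Proof.
move=> bk eirr umin hu hv us vs ut vt ns nt st sv tv.
have us' : q u < q s by apply: umin; rewrite eq_sym (adj_neq eirr).
have ut' : q u < q t by apply: umin; rewrite eq_sym (adj_neq eirr).
have := (hu _ us, hu _ ut, hv _ vs, hv _ vt) => -[[[h1 h2] h3] h4].
have : q s != q t by rewrite (eqtype.inj_eq bk.1).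
rewrite neq_ltn => /orP[lt|lt].
(* In the order [u], [s], [t], [v] the edges [ut] and [vs] cross; with only [A] and [B] available,
   both [us] and [ut] take the page that [vs] does not. *)
- have : pg u t <> pg v s by apply: (page_neq bk) => //; rewrite crossCr cross_lt.
  case: h1 => h1; case: h2 => h2; case: h3 => h3; case: h4 => h4; split; congruence.
- have : pg u s <> pg v t by apply: (page_neq bk) => //; rewrite crossCr cross_lt.
  case: h1 => h1; case: h2 => h2; case: h3 => h3; case: h4 => h4; split; congruence.
Qed.

Lemma third_vertex_left (T : finType) (e : rel T) pg q A B (u v s t w z y : T) :
    book_embedding e q pg -> symmetric e -> irreflexive e ->
    (forall x, x != u -> q u < q x) ->
    pages_within e pg A B u -> pages_within e pg A B v ->
    pages_within e pg A B s -> pages_within e pg A B t ->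
    unit_gadget e u v s t z y -> e u w -> e v w ->
    pg u s <> pg v s -> pg u t <> pg v t -> pg u w <> pg v w ->
    w != s -> w != t -> q s < q v -> q t < q v -> q w < q v -> False.
Proof.
move=> bk esym eirr umin hu hv.
wlog lst : s t / q s < q t => [th|].
  move=> hs ht g; have st : s != t by case/andP: g => /andP[/and5P[_ _ _ _ /(adj_neq eirr)]].
  move: (st); rewrite -(eqtype.inj_eq bk.1) neq_ltn => /orP[lst|lts]; first exact: th lst hs ht g.
  by move=> *; apply: (th t s) => //; rewrite unit_gadgetC.
move=> hs ht /andP[/andP[/and5P[us vs ut vt st] /and4P[uz sz tz zv]] /and4P[vy sy ty yu]].
move=> uw vw ns nt nw ws wt sv tv wv.
have [eut evt] : pg u s = pg u t /\ pg v s = pg v t.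
  by apply: (same_side_pattern bk eirr umin hu hv); rewrite ?(adj_neq eirr st).
have [euw evw] : pg u s = pg u w /\ pg v s = pg v w.
  by apply: (same_side_pattern bk eirr umin hu hv) => //; rewrite eq_sym.
have us' : q u < q s by apply: umin; rewrite eq_sym (adj_neq eirr us).
have uw' : q u < q w by apply: umin; rewrite eq_sym (adj_neq eirr uw).
have {}ws : q w != q s by rewrite (eqtype.inj_eq bk.1).
have {}wt : q w != q t by rewrite (eqtype.inj_eq bk.1).
(* As [us] and [vs] are on different pages, their labels exhaust [A] and [B]; by the pattern they
   are also the labels at [t] and [w]. *)
have cov c : c = A \/ c = B -> c = pg u s \/ c = pg v s.
  by move=> hc; case: hc (hu _ us) (hv _ vs) => -> [h|h] [h'|h'];
    (left; congruence) || (right; congruence).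
(* Otherwise [st] would cross both [uw] and [vw], which occupy both pages. *)
have nbtw : ~~ (q s < q w < q t).
  apply/negP => /andP[sw wt'].
  have : pg u w <> pg s t by apply: (page_neq bk) => //; apply: cross_lt.
  have : pg s t <> pg v w by apply: (page_neq bk) => //; rewrite crossCr cross_lt.
  by case: (cov _ (hs _ st)) => ->; congruence.
(* Before [s], the edge [tx] would cross [us] and [vs]; between [t] and [v], the edge [sx] would
   cross [ut] and [vt]. Beyond [v], [sx] is forced onto the page of [vs] and [tx] onto that of [us];
   then [sx] crosses [vw] if [w] precedes [s], and [tx] crosses [uw] if [w] follows [t]. *)
have btw x : e s x -> e t x -> x != u -> x != v -> q s < q x < q t.
  move=> sx tx xu xv.
  have xu' := umin _ xu.
  have {}xv : q x != q v by rewrite (eqtype.inj_eq bk.1).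
  have xs : q s != q x by rewrite (eqtype.inj_eq bk.1) (adj_neq eirr sx).
  have xt : q t != q x by rewrite (eqtype.inj_eq bk.1) (adj_neq eirr tx).
  have hsx := cov _ (hs _ sx); have htx := cov _ (ht _ tx).
  have tailx : q t < q x -> pg u t <> pg s x.
    by move=> tx'; apply: (page_neq bk) => //; apply: cross_lt.
  case: (ltngtP (q s) (q x)) xs => // [sx'|xs'] _; last first.
    have : pg u s <> pg t x by apply: (page_neq bk) => //; rewrite crossCr cross_lt.
    have : pg t x <> pg v s by apply: (page_neq bk) => //; rewrite crossCl crossCr cross_lt.
    by case: htx => ->.
  case: (ltngtP (q t) (q x)) xt => // tx' _.
  case: (ltngtP (q x) (q v)) xv => // [xv'|vx'] _; have {}tailx := tailx tx'.
    have : pg s x <> pg v t by apply: (page_neq bk) => //; rewrite crossCr cross_lt.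
    by case: hsx => h; congruence.
  have : pg v s <> pg t x by apply: (page_neq bk) => //; rewrite crossCl cross_lt.
  have [ws'|sw'] : q w < q s \/ q s < q w by apply/orP; rewrite -neq_ltn.
    have : pg v w <> pg s x by apply: (page_neq bk) => //; rewrite crossCl cross_lt.
    by case: hsx => h; congruence.
  have tw' : q t < q w.
    by move: nbtw wt; rewrite sw' /= -leqNgt leq_eqVlt eq_sym => /orP[->|].
  have : pg u w <> pg t x.
    apply: (page_neq bk) => //.
    by rewrite cross_lt //; [exact: ltn_trans lst|exact: ltn_trans vx'].
  by case: htx => h; congruence.
have zu : z != u by rewrite eq_sym (adj_neq eirr uz).
have yv : y != v by rewrite eq_sym (adj_neq eirr vy).
have := btw z sz tz zu zv; have := btw y sy ty yu yv => hy hz.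
have := (cov _ (hu _ uz), cov _ (hv _ vy), cov _ (hs _ st)) => -[[h1 h2] h3].
(* As [uz] crosses [vs] and [vy] crosses [ut], the edges [uz] and [vy] are on different pages; [st]
   crosses both. *)
case/andP: hy => sy' yt'; case/andP: hz => sz' zt'.
have : pg u z <> pg v s.
  by apply: (page_neq bk) => //; rewrite crossCr cross_lt // (ltn_trans zt').
have : pg u z <> pg s t by apply: (page_neq bk) => //; apply: cross_lt.
have : pg u t <> pg v y.
  by apply: (page_neq bk) => //; rewrite crossCr cross_lt // (ltn_trans us').
have : pg s t <> pg v y by apply: (page_neq bk) => //; rewrite crossCr cross_lt.
case: h1 => h1; case: h2 => h2; case: h3 => h3; congruence.
Qed.

(** As [uv] has only two sides, being on different sides adds modulo 2. *)
Lemma cross_parity (T : finType) (p : T -> nat) u v a b c :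
    injective p -> a \notin [:: u; v] -> b \notin [:: u; v] -> c \notin [:: u; v] ->
  cross p u v b c = cross p u v a b (+) cross p u v a c.
Proof.
move=> injp; rewrite !inE -!(eqtype.inj_eq injp) !negb_or.
move=> /andP[au av] /andP[bu bv] /andP[cu cv].
by rewrite !cross_inside //; do 3 case: inside.
Qed.

Lemma cross_first (T : finType) (q : T -> nat) u v a b :
    injective q -> (forall x, x != u -> q u < q x) -> u != v -> a \notin [:: u; v] ->
    b \notin [:: u; v] -> q a < q v -> cross q u v a b = (q v < q b).
Proof.
move=> injq umin uv; rewrite !inE !negb_or => /andP[au av] /andP[bu bv] lav.
have ins x : x != u -> inside q u v x = (q x < q v).
  have luv : q u <= q v by apply: ltnW; rewrite umin // eq_sym.
  by move=> xu; rewrite /inside /lo /hi (minn_idPl luv) (maxn_idPr luv) umin.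
rewrite cross_inside ?(eqtype.inj_eq injq) // !ins // lav /=.
by rewrite -leqNgt leq_eqVlt eq_sym (eqtype.inj_eq injq) (negPf bv).
Qed.

Lemma notin_ends (T : finType) (e : rel T) u v x :
  irreflexive e -> e u x -> e v x -> x \notin [:: u; v].
Proof.
by move=> eirr /(adj_neq eirr) ux /(adj_neq eirr) vx; rewrite !inE !(eq_sym x) negb_or ux.
Qed.

Definition splits (T : finType) (e : rel T) (pg : T -> T -> nat) u v x :=
  [&& e u x, e v x & pg u x != pg v x].

Definition good_unit (T : finType) (e : rel T) pg A B (u v s t z y : T) :=
  [/\ unit_gadget e u v s t z y, pages_within e pg A B s, pages_within e pg A B t,
      splits e pg u v s & splits e pg u v t].

(** This frees [third_vertex_left] from the normalised order: [rotate_book] makes the side of [s]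
    the interval before [v]. *)
Lemma third_vertex (T : finType) (e : rel T) pg p A B (u v s t w z y : T) :
    book_embedding e p pg -> symmetric e -> irreflexive e -> u != v ->
    pages_within e pg A B u -> pages_within e pg A B v ->
    good_unit e pg A B u v s t z y -> splits e pg u v w -> w != s -> w != t ->
  ~~ cross p u v s t -> cross p u v s w.
Proof.
move=> bk esym eirr uv hu hv [g hs ht /and3P[us vs /eqP ns] /and3P[ut vt /eqP nt]].
move=> /and3P[uw vw /eqP nw] ws wt st; apply: contraT => sw.
have su := notin_ends eirr us vs; have tu := notin_ends eirr ut vt.
have wu := notin_ends eirr uw vw.
have [] := @rotate_book _ e p pg u v s bk uv.
- by move: su; rewrite !inE negb_or => /andP[].
- by move: su; rewrite !inE negb_or => /andP[].
move=> q [bkq qX umin sv].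
have := third_vertex_left bkq esym eirr umin hu hv hs ht g uw vw ns nt nw ws wt sv.
have left x : x \notin [:: u; v] -> ~~ cross p u v s x -> q x < q v.
  move=> xu; rewrite -qX (cross_first bkq.1 umin uv su xu sv) -leqNgt leq_eqVlt.
  by rewrite (eqtype.inj_eq bkq.1); move: xu; rewrite !inE negb_or => /andP[_ /negPf ->].
by move=> /(_ (left _ tu st) (left _ wu sw)).
Qed.

(** Let [b] be the middle one of the three, between [a] and [c]. Its edge to the other side of [uv]
    crosses [va] and [uc], which lie on different pages by [same_side_pattern], so neither [A] nor
    [B] is left for it. *)
Lemma three_exits (T : finType) (e : rel T) pg p A B (u v x1 x2 x3 r1 r2 r3 : T) :
    book_embedding e p pg -> irreflexive e -> u != v ->
    pages_within e pg A B u -> pages_within e pg A B v -> uniq [:: x1; x2; x3] ->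
    (forall x r, (x, r) \in [:: (x1, r1); (x2, r2); (x3, r3)] ->
       [/\ splits e pg u v x, pages_within e pg A B x, e x r, r \notin [:: u; v]
           & cross p u v x r && ~~ cross p u v x1 x]) ->
  False.
Proof.
move=> bk eirr uv hu hv ux H.
have m1 : (x1, r1) \in [:: (x1, r1); (x2, r2); (x3, r3)] by rewrite !inE eqxx.
have m2 : (x2, r2) \in [:: (x1, r1); (x2, r2); (x3, r3)] by rewrite !inE eqxx orbT.
have m3 : (x3, r3) \in [:: (x1, r1); (x2, r2); (x3, r3)] by rewrite !inE eqxx !orbT.
have out x r : (x, r) \in [:: (x1, r1); (x2, r2); (x3, r3)] -> x \notin [:: u; v].
  by case/H => /and3P[ux' vx _] *; apply: notin_ends ux' vx.
have := out _ _ m1; rewrite !inE negb_or => /andP[x1u x1v].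
have [q [bkq qX umin qx1]] := rotate_book bk uv x1u x1v.
have left x r (m : (x, r) \in [:: (x1, r1); (x2, r2); (x3, r3)]) : q x < q v.
  have [_ _ _ _ /andP[_]] := H _ _ m; have xu := out _ _ m.
  rewrite -qX (cross_first bkq.1 umin uv (out _ _ m1) xu qx1) -leqNgt leq_eqVlt.
  by rewrite (eqtype.inj_eq bkq.1); move: xu; rewrite !inE negb_or => /andP[_ /negPf ->].
have mid a ra b rb c rc : (a, ra) \in [:: (x1, r1); (x2, r2); (x3, r3)] ->
    (b, rb) \in [:: (x1, r1); (x2, r2); (x3, r3)] ->
    (c, rc) \in [:: (x1, r1); (x2, r2); (x3, r3)] -> q a < q b -> q b < q c -> False.
  move=> ma mb mc ab bc.
  have [/and3P[ua va /eqP na] _ _ _ _] := H _ _ ma.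
  have [/and3P[uc vc /eqP nc] _ _ _ _] := H _ _ mc.
  have [/and3P[ub vb /eqP nb] hb br ru /andP[Xr _]] := H _ _ mb.
  have rv : q v < q rb.
    by rewrite -(cross_first bkq.1 umin uv (out _ _ mb) ru (left _ _ mb)) qX.
  have neq x y : q x < q y -> x != y by move=> xy; apply: contraTneq xy => ->; rewrite ltnn.
  have [eab1 eab2] := same_side_pattern bkq eirr umin hu hv ua va ub vb na nb
    (neq _ _ ab) (left _ _ ma) (left _ _ mb).
  have [ebc1 ebc2] := same_side_pattern bkq eirr umin hu hv ub vb uc vc nb nc
    (neq _ _ bc) (left _ _ mb) (left _ _ mc).
  have qub : q u < q b by apply: umin; rewrite eq_sym (adj_neq eirr ub).
  have n1 : pg u c <> pg b rb.
    by apply: (page_neq bkq) => //; apply: cross_lt => //; apply: ltn_trans rv; apply: left mc.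
  have n2 : pg v a <> pg b rb.
    by apply: (page_neq bkq) => //; rewrite crossCl cross_lt //; apply: left mb.
  by case: (hb _ br) (hu _ ub) (hv _ vb) => h [h'|h'] [h''|h'']; congruence.
move: ux; rewrite /= !inE negb_or -!(eqtype.inj_eq bkq.1) andbT => /andP[/andP[n12 n13] n23].
move: n12 n13 n23; rewrite !neq_ltn => /orP[l12|l21] /orP[l13|l31] /orP[l23|l32].
- exact: mid m1 m2 m3 l12 l23.
- exact: mid m1 m3 m2 l13 l32.
- exact: mid m3 m1 m2 l31 l12.
- exact: mid m3 m1 m2 l31 l12.
- exact: mid m2 m1 m3 l21 l13.
- exact: mid m2 m1 m3 l21 l13.
- exact: mid m2 m3 m1 l23 l31.
- exact: mid m3 m2 m1 l32 l21.
Qed.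

Lemma three_good_units (T : finType) (e : rel T) pg p A B (u v : T) (s t z y : 'I_3 -> T) :
    book_embedding e p pg -> symmetric e -> irreflexive e -> u != v ->
    pages_within e pg A B u -> pages_within e pg A B v ->
    (forall i, good_unit e pg A B u v (s i) (t i) (z i) (y i)) ->
    injective s -> injective t -> (forall i j, s i != t j) -> False.
Proof.
move=> bk esym eirr uv hu hv g injs injt nst.
have ps i : splits e pg u v (s i) by have [] := g i.
have pt i : splits e pg u v (t i) by have [] := g i.
have outs i : s i \notin [:: u; v].
  by case/and3P: (ps i) => us vs _; apply: notin_ends us vs.
have outt i : t i \notin [:: u; v].
  by case/and3P: (pt i) => ut vt _; apply: notin_ends ut vt.
have par a b c := @cross_parity _ p u v a b c bk.1.
have far i w : ~~ cross p u v (s i) (t i) -> splits e pg u v w -> w != s i -> w != t i ->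
    cross p u v (s i) w.
  by move=> h pw ws wt; apply: (third_vertex bk esym eirr uv hu hv (g i)).
have ns i j : i != j -> s j != s i by move=> ij; rewrite (eqtype.inj_eq injs) eq_sym.
have nt i j : i != j -> t j != t i by move=> ij; rewrite (eqtype.inj_eq injt) eq_sym.
(* If [s i] and [t i] shared a side, [third_vertex] would put [s j], [t j] and [s k] all on the
   other one, which contradicts [third_vertex] for unit [j]. *)
have opp i : cross p u v (s i) (t i).
  apply: contraT => ci.
  have [j [k [ij ik jk]]] : exists j k, [/\ i != j, i != k & j != k].
    by case: i {ci} => -[|[|[|//]]] Hi;
      [exists (inord 1), (inord 2)|exists (inord 0), (inord 2)|exists (inord 0), (inord 1)];
      rewrite -!val_eqE /= !inordK.
  have c1 : cross p u v (s i) (s j) by apply: far; rewrite ?ns ?nst.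
  have c2 : cross p u v (s i) (t j) by apply: far; rewrite ?nt // eq_sym.
  have c3 : cross p u v (s i) (s k) by apply: far; rewrite ?ns ?nst.
  have cj : ~~ cross p u v (s j) (t j) by rewrite (par (s i)) // c1 c2.
  by have := far j (s k) cj (ps k); rewrite ns // nst (par (s i)) // c1 c3 => /(_ isT isT).
(* Each unit has one vertex on the side of [s ord0]: [x i] is that vertex, [r i] its partner across
   [uv]. *)
pose near i := ~~ cross p u v (s ord0) (s i).
pose x i := if near i then s i else t i.
pose r i := if near i then t i else s i.
have hx i : [/\ splits e pg u v (x i), pages_within e pg A B (x i), e (x i) (r i),
    r i \notin [:: u; v] & cross p u v (x i) (r i) && ~~ cross p u v (s ord0) (x i)].
  have [/andP[/andP[/and5P[_ _ _ _ st] _] _] hs ht _ _] := g i.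
  rewrite /x /r; case: ifP => [h|/negbFE h]; first by split=> //; rewrite opp.
  by split=> //; rewrite 1?esym // crossCr opp (par (s i)) // crossCr h opp.
have x0 : x ord0 = s ord0.
  have := par _ _ _ (outs ord0) (outs ord0) (outs ord0).
  by rewrite /x /near; case: cross.
have injx i j : i != j -> x i != x j.
  rewrite eq_sym => ij; rewrite /x; case: ifP => _; case: ifP => _; rewrite ?ns ?nt ?nst //.
  by rewrite eq_sym nst.
have := @three_exits _ e pg p A B u v (x ord0) (x (inord 1)) (x (inord 2))
  (r ord0) (r (inord 1)) (r (inord 2)) bk eirr uv hu hv.
apply.
- by rewrite /= !inE !negb_or !injx -?val_eqE /= ?inordK.
- move=> a b m; rewrite !inE in m; rewrite [X in cross _ _ _ X a]x0.
  by move: m => /or3P[] /eqP[-> ->]; apply: hx.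
Qed.

(** * Counting units and finding a two-page edge *)

(** The pairings [ua], [vb] and [ub], [va] use a single page and cannot cross, so the third one
    does. Here [uv] and [ab] are pairs of positions rather than edges. *)
Lemma two_edge_pairs_cross (T : finType) (e : rel T) pg p (u v a b : T) A :
    book_embedding e p pg -> uniq [:: u; v; a; b] ->
    e u a -> e v a -> e u b -> e v b ->
    pg u a = A -> pg v a = A -> pg u b = A -> pg v b = A -> cross p u v a b.
Proof.
move=> bk un ua va ub vb pua pva pub pvb.
have [injp [_ nX]] := bk.
have := @cross_one_pairing _ p u v a b; rewrite map_inj_uniq // => /(_ un).
have /negPf -> : ~~ cross p u a v b by apply: nX => //; rewrite pua pvb.
have /negPf -> : ~~ cross p u b v a by apply: nX => //; rewrite pub pva.
by rewrite !orbF.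
Qed.

(** The vertices [a], [b], [c] would lie pairwise on different sides of [uv], which has only two. *)
Lemma no_monochromatic_K23 (T : finType) (e : rel T) pg p (u v a b c : T) A :
    book_embedding e p pg -> irreflexive e -> u != v -> uniq [:: a; b; c] ->
    (forall x, x \in [:: a; b; c] -> [/\ e u x, e v x, pg u x = A & pg v x = A]) -> False.
Proof.
move=> bk eirr uv; rewrite /= !inE negb_or andbT => /andP[/andP[ab ac] bc] H.
have cr x y : x \in [:: a; b; c] -> y \in [:: a; b; c] -> x != y -> cross p u v x y.
  move=> /H[ux vx pux pvx] /H[uy vy puy pvy] xy.
  apply: (two_edge_pairs_cross bk) pux pvx puy pvy => //.
  by rewrite /= !inE !negb_or uv xy !(adj_neq eirr).
have out x : x \in [:: a; b; c] -> x \notin [:: u; v].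
  by move=> /H[ux vx _ _]; apply: notin_ends ux vx.
have [ia ib ic] : [/\ a \in [:: a; b; c], b \in [:: a; b; c] & c \in [:: a; b; c]].
  by rewrite !inE !eqxx !orbT.
have := @cross_parity _ p u v a b c bk.1 (out _ ia) (out _ ib) (out _ ic).
by rewrite !cr.
Qed.

Lemma seven_units (T : finType) (e : rel T) pg p A B (u v : T) (s t z y : 'I_7 -> T) :
    book_embedding e p pg -> symmetric e -> irreflexive e -> u != v ->
    (forall x a b c, e x a -> e x b -> e x c -> pg x a <> pg x b ->
       pg x c = pg x a \/ pg x c = pg x b) ->
    pages_within e pg A B u -> pages_within e pg A B v ->
    (forall i, unit_gadget e u v (s i) (t i) (z i) (y i)) ->
    injective s -> injective t -> (forall i j, s i != t j) -> False.
Proof.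
move=> bk esym eirr uv loc hu hv g injs injt nst.
pose mono C x := (pg u x == C) && (pg v x == C).
pose bad C := [set i | mono C (s i) || mono C (t i)].
have us i : e u (s i) by case/andP: (g i) => /andP[/and5P[]].
have vs i : e v (s i) by case/andP: (g i) => /andP[/and5P[]].
have ut i : e u (t i) by case/andP: (g i) => /andP[/and5P[]].
have vt i : e v (t i) by case/andP: (g i) => /andP[/and5P[]].
(* Three units bad for the same page [C] would give a [K_{2,3}] on [C]. *)
have card_bad C : #|bad C| <= 2.
  rewrite leqNgt; apply/card_gt2P => -[i [j [k [[hi hj hk] [ij jk ki]]]]].
  pose x i := if mono C (s i) then s i else t i.
  have nx l m : l != m -> x l != x m.
    move=> lm; rewrite /x; case: ifP => _; case: ifP => _;
      rewrite ?nst ?(eqtype.inj_eq injs) ?(eqtype.inj_eq injt) //.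
    by rewrite eq_sym nst.
  have hx l : l \in bad C -> [/\ e u (x l), e v (x l), pg u (x l) = C & pg v (x l) = C].
    rewrite inE /x; case: ifP => [/andP[/eqP ? /eqP ?] _|_ /= /andP[/eqP ? /eqP ?]]; by split.
  apply: (@no_monochromatic_K23 _ e pg p u v (x i) (x j) (x k) C bk eirr uv).
    by rewrite /= !inE negb_or !nx // eq_sym.
  by move=> w; rewrite !inE => /or3P[] /eqP->; apply: hx.
(* At most two units are bad for [A] and two for [B], so three of the seven remain. *)
have : 2 < #|~: (bad A :|: bad B)|.
  have := cardsC (bad A :|: bad B); rewrite card_ord.
  have [+ _] := leq_card_setU (bad A) (bad B); have := card_bad A; have := card_bad B; lia.
case/card_gt2P=> i [j [k [[hi hj hk] [ij jk ki]]]].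
pose f (n : 'I_3) := nth i [:: i; j; k] n.
have injf : injective f.
  move=> a b /eqP; rewrite nth_uniq ?ltn_ord //; first by move/eqP/val_inj.
  by rewrite /= !inE negb_or ij jk eq_sym ki.
(* The edges [ux] and [vx] show two pages at [x], both among [A] and [B]; [loc] excludes a third. *)
have split_within x : e u x -> e v x -> ~~ mono A x -> ~~ mono B x ->
    pages_within e pg A B x /\ splits e pg u v x.
  move=> ux vx nA nB.
  have nx : pg u x <> pg v x.
    move=> h; move: nA nB; rewrite /mono -h !andbb => /eqP nA /eqP nB.
    by case: (hu _ ux).
  split; last by apply/and3P; split=> //; apply/eqP.
  have [_ [pgC _]] := bk.
  move=> w xw; have := @loc x u v w; rewrite (esym x u) (esym x v) -(pgC _ _ ux) -(pgC _ _ vx).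
  move=> /(_ ux vx xw nx); have := hu _ ux; have := hv _ vx.
  by move=> [->|->] [->|->] [->|->]; (by left) || (by right).
apply: (@three_good_units _ e pg p A B u v (s \o f) (t \o f) (z \o f) (y \o f)) => //.
- move=> n /=; have : f n \in ~: (bad A :|: bad B).
    by rewrite /f; case: n => -[|[|[|//]]].
  rewrite !inE !negb_or => /andP[/andP[sA tA] /andP[sB tB]].
  have [? ?] := split_within _ (us (f n)) (vs (f n)) sA sB.
  have [? ?] := split_within _ (ut (f n)) (vt (f n)) tA tB.
  by split.
- exact: inj_comp injs injf.
- exact: inj_comp injt injf.
- by move=> a b; apply: nst.
Qed.

(* The two pages at [x] propagate around the triangle [xyz] with three pages at most, one pair
   of which the fourth vertex has to repeat. *)
Lemma K4_pair (T : finType) (e : rel T) pg (x y z w : T) :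
    (forall a b, e a b -> pg a b = pg b a) -> symmetric e ->
    (forall x a b c, e x a -> e x b -> e x c -> pg x a <> pg x b ->
       pg x c = pg x a \/ pg x c = pg x b) ->
    e x y -> e x z -> e x w -> e y z -> e y w -> e z w -> pg x y <> pg x z ->
  exists a b A B, [/\ a \in [:: x; y; z; w], b \in [:: x; y; z; w], e a b,
    pages_within e pg A B a & pages_within e pg A B b].
Proof.
move=> pgC symE loc xy xz xw yz yw zw nyz.
have within a b c A B : e a b -> e a c -> pg a b = A -> pg a c = B -> A <> B ->
    pages_within e pg A B a.
  by move=> ab ac <- <- n d ad; apply: loc.
have [yx zx zy] : [/\ e y x, e z x & e z y] by rewrite !(symE _ x) (symE z).
have [wx wy wz] : [/\ e w x, e w y & e w z] by rewrite !(symE w).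
have Pyx := pgC _ _ xy; have Pzx := pgC _ _ xz; have Pzy := pgC _ _ yz.
have Pwx := pgC _ _ xw; have Pwy := pgC _ _ yw; have Pwz := pgC _ _ zw.
have [ix iy iz iw] : [/\ x \in [:: x; y; z; w], y \in [:: x; y; z; w],
    z \in [:: x; y; z; w] & w \in [:: x; y; z; w]] by rewrite !inE !eqxx !orbT.
have hx : pages_within e pg (pg x y) (pg x z) x by apply: within xy xz _ _ nyz.
have [eyz|nzy] := eqVneq (pg y z) (pg x y).
  exists x, z, (pg x y), (pg x z); split=> //.
  by apply: (within z y x) => //; rewrite -?Pzy -?Pzx.
have [eyz|nzy'] := eqVneq (pg y z) (pg x z).
  exists x, y, (pg x y), (pg x z); split=> //.
  by apply: (within y x z).
move: nzy nzy' => /eqP nzy /eqP nzy'.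
have hy : pages_within e pg (pg x y) (pg y z) y.
  by apply: (within y x z) => //; apply: nesym.
have hz : pages_within e pg (pg x z) (pg y z) z.
  by apply: (within z x y) => //; apply: nesym.
have goal a A B : a \in [:: x; y; z] -> pages_within e pg A B a ->
    (exists b c, [/\ e w b, e w c, pg b w = A, pg c w = B & A <> B]) ->
  exists a b A B, [/\ a \in [:: x; y; z; w], b \in [:: x; y; z; w], e a b,
    pages_within e pg A B a & pages_within e pg A B b].
  move=> ia ha [b [c [wb wc eb ec nAB]]]; exists a, w, A, B; split=> //.
  - by move: ia; rewrite !inE => /or3P[] ->; rewrite ?orbT.
  - by move: ia; rewrite !inE => /or3P[] /eqP->.
  - by apply: (within w b c) => //; rewrite pgC.
have [jx jy jz] : [/\ x \in [:: x; y; z], y \in [:: x; y; z] & z \in [:: x; y; z]].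
  by rewrite !inE !eqxx !orbT.
(* The three triangle pages are distinct and none is allowed on all of [xw], [yw], [zw]. Hence [w]
   sees two of them, which are the pair of [x], [y] or [z]. *)
case: (hx _ xw) (hy _ yw) (hz _ zw) => ex [] ey [] ez.
- by apply: (goal x _ _ jx hx); exists x, z.
- by apply: (goal y _ _ jy hy); exists x, z; split=> //; apply: nesym.
- by apply: (goal x _ _ jx hx); exists x, z.
- by apply: (goal y _ _ jy hy); exists x, y; split=> //; apply: nesym.
- by apply: (goal x _ _ jx hx); exists y, z.
- by apply: (goal x _ _ jx hx); exists y, x.
- by apply: (goal z _ _ jz hz); exists x, y; split=> //; apply: nesym.
- by apply: (goal z _ _ jz hz); exists x, y; split=> //; apply: nesym.
Qed.

(** A vertex that sees two pages can play the role of [x] in [K4_pair]; without one, all six edges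
    share a page, although one of the three pairings crosses. *)
Lemma K4_two_page_edge (T : finType) (e : rel T) pg p (x y z w : T) :
    book_embedding e p pg -> symmetric e -> uniq [:: x; y; z; w] ->
    (forall x a b c, e x a -> e x b -> e x c -> pg x a <> pg x b ->
       pg x c = pg x a \/ pg x c = pg x b) ->
    e x y -> e x z -> e x w -> e y z -> e y w -> e z w ->
  exists a b A B, [/\ a \in [:: x; y; z; w], b \in [:: x; y; z; w], e a b,
    pages_within e pg A B a & pages_within e pg A B b].
Proof.
move=> bk symE un loc xy xz xw yz yw zw; have [injp [pgC nX]] := bk.
have [yx zx zy] : [/\ e y x, e z x & e z y] by rewrite !(symE _ x) (symE z).
have [wx wy wz] : [/\ e w x, e w y & e w z] by rewrite !(symE w).
have step a b c d : {subset [:: a; b; c; d] <= [:: x; y; z; w]} ->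
    e a b -> e a c -> e a d -> e b c -> e b d -> e c d -> pg a b <> pg a c ->
  exists a b A B, [/\ a \in [:: x; y; z; w], b \in [:: x; y; z; w], e a b,
    pages_within e pg A B a & pages_within e pg A B b].
  move=> sub ab ac ad bc bd cd n.
  have [a' [b' [A [B [/sub ha /sub hb *]]]]] := K4_pair pgC symE loc ab ac ad bc bd cd n.
  by exists a', b', A, B.
have [e1|/eqP n] := eqVneq (pg x y) (pg x z); last by apply: (step x y z w).
have [e2|/eqP n] := eqVneq (pg x y) (pg x w); last first.
  by apply: (step x y w z) => // a; rewrite !inE => /or4P[] ->; rewrite ?orbT.
have [e3|/eqP n] := eqVneq (pg y x) (pg y z); last first.
  by apply: (step y x z w) => // a; rewrite !inE => /or4P[] ->; rewrite ?orbT.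
have [e4|/eqP n] := eqVneq (pg y x) (pg y w); last first.
  by apply: (step y x w z) => // a; rewrite !inE => /or4P[] ->; rewrite ?orbT.
have [e5|/eqP n] := eqVneq (pg z x) (pg z w); last first.
  by apply: (step z x w y) => // a; rewrite !inE => /or4P[] ->; rewrite ?orbT.
have yxE := pgC _ _ xy; have zxE := pgC _ _ xz.
have := @cross_one_pairing _ p x y z w; rewrite map_inj_uniq // => /(_ un).
have /negPf -> : ~~ cross p x y z w by apply: nX => //; congruence.
have /negPf -> : ~~ cross p x z y w by apply: nX => //; congruence.
by have /negPf -> : ~~ cross p x w y z by apply: nX => //; congruence.
Qed.

Lemma two_local_pages (T : finType) (e : rel T) pg (x a b c : T) :
    size (pages_at e pg x) <= 2 -> e x a -> e x b -> e x c -> pg x a <> pg x b ->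
  pg x c = pg x a \/ pg x c = pg x b.
Proof.
move=> sz xa xb xc /eqP nab.
have mem w : e x w -> pg x w \in pages_at e pg x.
  by move=> xw; rewrite mem_undup map_f // mem_filter xw mem_enum.
have [->|nca] := eqVneq (pg x c) (pg x a); first by left.
have [->|ncb] := eqVneq (pg x c) (pg x b); first by right.
suff : 3 <= size (pages_at e pg x) by rewrite leqNgt ltnS sz.
apply: (@uniq_leq_size _ [:: pg x a; pg x b; pg x c]).
  by rewrite /= !inE negb_or nab !(eq_sym _ (pg x c)) nca ncb.
by move=> m; rewrite !inE => /or3P[] /eqP->; apply: mem.
Qed.

(** * The graph *)

Definition hub_edges : seq (nat * nat) := [:: (0, 1); (1, 2); (0, 2); (0, 3); (1, 3); (2, 3)].

Definition unit_ends (k : nat) : nat * nat := nth (0, 0) hub_edges (k %/ 7).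

(* Vertices 0..3 are the hubs; the [k]-th of the 42 units consists of the vertices
   [s, z, y, t = b, b+1, b+2, b+3] with [b = 4k+4] and belongs to hub edge number [k %/ 7]. *)
Definition unit_edges (k : nat) : seq (nat * nat) :=
  let: (u, v) := unit_ends k in let b := 4 * k + 4 in
  [:: (u, b); (u, b.+1); (u, b.+3); (v, b); (v, b.+2); (v, b.+3);
      (b, b.+1); (b, b.+2); (b, b.+3); (b.+1, b.+3); (b.+2, b.+3)].

Definition edges : seq (nat * nat) := hub_edges ++ flatten [seq unit_edges k | k <- iota 0 42].

Definition adj (x y : nat) : bool := ((x, y) \in edges) || ((y, x) \in edges).

(** The order is [172 = 4 + 4 * 42]. *)
Definition G_rel : rel 'I_172 := fun x y => adj x y.

Lemma G_sym : symmetric G_rel.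
Proof. by move=> x y; rewrite /G_rel /adj orbC. Qed.

Lemma edges_lt : all (fun c => (c.1 < c.2) && (c.2 < 172)) edges.
Proof. by vm_compute. Qed.

Lemma G_irr : irreflexive G_rel.
Proof.
move=> x; rewrite /G_rel /adj orbb; apply: contraTF isT => /(allP edges_lt).
by rewrite ltnn.
Qed.

Lemma G_inord a b : a < 172 -> b < 172 -> G_rel (inord a) (inord b) = adj a b.
Proof. by move=> ha hb; rewrite /G_rel !inordK. Qed.

Lemma unit_gadgets :
  all (fun k => let b := 4 * k + 4 in
    unit_gadget adj (unit_ends k).1 (unit_ends k).2 b b.+3 b.+1 b.+2) (iota 0 42).
Proof. by vm_compute. Qed.

(** * Local page number of the graph *)

Lemma G_not_2_local : ~ k_local_book_embedding G_rel 2.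
Proof.
case=> p [pg [bk sz]].
have loc x a b c := @two_local_pages _ G_rel pg x a b c (sz x).
pose h k : 'I_172 := inord k.
have hE k : k < 172 -> h k = k :> nat by move=> hk; rewrite inordK.
have [] := @K4_two_page_edge _ G_rel pg p (h 0) (h 1) (h 2) (h 3) bk G_sym.
- by rewrite /= !inE -!val_eqE /= !hE.
- exact: loc.
1-6: by rewrite G_inord //; vm_compute.
move=> a [b [A [B [ha hb ab wa wb]]]].
wlog abE : a b ha hb ab wa wb / (val a, val b) \in edges.
  move=> th; case/orP: (ab) => m; first exact: (th a b).
  by apply: (th b a) => //; rewrite G_sym.
have lt4 c : c \in [:: h 0; h 1; h 2; h 3] -> c < 4.
  by rewrite !inE => /or4P[] /eqP->; rewrite hE.
have abH : (val a, val b) \in hub_edges.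
  have : all (fun c => (c.1 < 4) && (c.2 < 4) ==> (c \in hub_edges)) edges by vm_compute.
  by move=> /allP /(_ _ abE); rewrite !lt4.
pose g := index (val a, val b) hub_edges.
have g6 : g < 6 by rewrite -[6]/(size hub_edges) index_mem.
(* The units of hub edge number [g] are those numbered [7g] to [7g + 6]. *)
pose k (i : 'I_7) := 7 * g + i.
have k42 i : k i < 42.
  have : i < 7 := ltn_ord i; rewrite /k; move: g6; move: {k} g (val i) => n m; clear; lia.
have ke i : unit_ends (k i) = (val a, val b).
  rewrite /unit_ends /k mulnC divnMDl // divn_small ?ltn_ord // addn0.
  by rewrite nth_index.
pose s i := h (4 * k i + 4); pose t i := h (4 * k i + 4).+3.
pose z i := h (4 * k i + 4).+1; pose y i := h (4 * k i + 4).+2.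
have bnd i : 4 * k i + 4 < 169 by move: (k i) (k42 i) => n; clear; lia.
have nab : a != b by apply: (adj_neq G_irr).
have hv i : [/\ s i = 4 * k i + 4 :> nat, t i = (4 * k i + 4).+3 :> nat,
   z i = (4 * k i + 4).+1 :> nat & y i = (4 * k i + 4).+2 :> nat].
  have b3 := bnd i; have b2 := leqW b3; have b1 := leqW b2.
  by split; apply: hE => //; apply: leqW.
have kI i j : 4 * k i + 4 = 4 * k j + 4 -> i = j.
  move=> h4; apply: val_inj; apply: (@addnI (7 * g)); rewrite -/(k i) -/(k j).
  by move: (k i) (k j) h4 => n m; clear; lia.
apply: (@seven_units _ G_rel pg p A B a b s t z y bk G_sym G_irr) => //.
- move=> i; have -> : unit_gadget G_rel a b (s i) (t i) (z i) (y i) =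
      unit_gadget adj a b (s i) (t i) (z i) (y i) by [].
  have [-> -> -> ->] := hv i.
  have := allP unit_gadgets (k i); rewrite mem_iota k42 => /(_ isT).
  by rewrite ke.
- by move=> i j /(congr1 val) /=; have [-> _ _ _] := hv i; have [-> _ _ _] := hv j => /kI.
- by move=> i j /(congr1 val) /=; have [_ -> _ _] := hv i; have [_ -> _ _] := hv j => -[/kI].
- move=> i j; rewrite -val_eqE /=; have [-> _ _ _] := hv i; have [_ -> _ _] := hv j.
  by apply/eqP; move: (k i) (k j) => n m; clear; lia.
Qed.

(* Every hub edge and hub-unit edge is on the page of one of its hubs, so that such a page is
   a star up to edges [sy]; page 4 carries the rest of the units. *)
Definition page_of (x y : nat) : nat :=
  let a := minn x y in let b := maxn x y in
  if b < 4 then (if b == 3 then 3 else if b == a.+1 then a else b)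
  else if a < 4 then a
  else if (4 %| a) && (b == a.+2) then (unit_ends (a %/ 4).-1).2 else 4.

Definition lt_cross (a b c d : nat) : bool := [&& a < c, c < b & b < d].

(** On page 4 the edge [sy] would cross [zt]. On the page of the second hub [v] it passes only over
    [z], which is not adjacent to [v]. *)
Lemma page_edges_noncrossing :
  all (fun c => let p := page_of c.1 c.2 in
    all (fun d => (p == page_of d.1 d.2) ==> ~~ lt_cross c.1 c.2 d.1 d.2) edges) edges.
Proof. by vm_compute. Qed.

(** The edges of the triangle on hubs 0, 1, 2 are distributed cyclically and all edges among hubs at
    3 go to page 3, so no hub sees more than three pages. *)
Definition pages_near (x : nat) : seq nat :=
  if x < 4 then nth [::] [:: [:: 0; 2; 3]; [:: 0; 1; 3]; [:: 1; 2; 3]; [:: 3]] x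
  else let: (u, v) := unit_ends (x %/ 4).-1 in [:: u; v; 4].

Lemma page_near :
  all (fun c => let p := page_of c.1 c.2 in
    (p \in pages_near c.1) && (p \in pages_near c.2)) edges.
Proof. by vm_compute. Qed.

Lemma G_3_local : k_local_book_embedding G_rel 3.
Proof.
exists val, (fun x y : 'I_172 => page_of x y); split; first split.
- exact: val_inj.
- split=> [x y _|x y z w xy zw]; first by rewrite /page_of minnC maxnC.
  have lt a b : (a, b) \in edges -> a < b by move=> /(allP edges_lt) /andP[].
  have main a b c d : (a, b) \in edges -> (c, d) \in edges -> page_of a b = page_of c d ->
      ~~ lt_cross a b c d.
    move=> ab cd pE; have := allP (allP page_edges_noncrossing _ ab) _ cd.
    by rewrite /= pE eqxx.
  have pC a b : page_of a b = page_of b a by rewrite /page_of minnC maxnC.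
  wlog xy' : x y {xy} / (val x, val y) \in edges.
    move=> th; case/orP: xy => [|] xy; first exact: th.
    by rewrite pC crossCl; apply: th.
  wlog zw' : z w {zw} / (val z, val w) \in edges.
    move=> th; case/orP: zw => [|] zw; first exact: th.
    by rewrite (pC z) crossCr; apply: th.
  move=> pE; rewrite cross_sorted; try by apply: ltnW; apply: lt.
  have := main _ _ _ _ xy' zw' pE; have := main _ _ _ _ zw' xy' (esym pE).
  by rewrite /lt_cross negb_or -!andbA => -> ->.
- move=> x; apply: (@leq_trans (size (pages_near x))).
    apply: uniq_leq_size; first exact: undup_uniq.
    move=> m; rewrite mem_undup => /mapP[w]; rewrite mem_filter => /andP[xw _] ->.
    case/orP: xw => /(allP page_near) /andP[] //=.
    by rewrite /page_of minnC maxnC.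
  rewrite /pages_near; case: ifP => _; last by case: unit_ends.
  by case: (val x) => [|[|[|[|n]]]] //=; rewrite nth_nil.
Qed.

(** * A straight-line drawing *)

Definition point : Type := (Z * Z)%type.

Definition point_eqb (P Q : point) : bool := Z.eqb P.1 Q.1 && Z.eqb P.2 Q.2.

(** This is twice the signed area of the triangle [PQX]. *)
Definition orient (P Q X : point) : Z :=
  ((Q.1 - P.1) * (X.2 - P.2) - (Q.2 - P.2) * (X.1 - P.1))%Z.

(* [XY] is on one side of the line [PQ] and meets it in an endpoint at most. *)
Definition on_side (P Q X Y : point) : bool :=
  let a := orient P Q X in let b := orient P Q Y in
  [&& Z.leb 0 a, Z.leb 0 b & Z.ltb 0 (a + b)] || [&& Z.leb a 0, Z.leb b 0 & Z.ltb (a + b) 0].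

(** Hub 3 lies inside the triangle of the others; each of the three inner faces hosts the units of
    the hub edges numbered [g] and [g + 3]. *)
Definition hub_point (x : nat) : point :=
  nth (0, 0)%Z [:: (0, 0); (30, 0); (0, 30); (9, 10)]%Z x.

(* A point close to the centroid of the face of [K4] that hosts the units of hub edge [g]. *)
Definition apex (g : nat) : point :=
  nth (0, 0)%Z [:: (13, 3); (13, 13); (3, 13); (14, 4); (14, 12); (3, 14)]%Z g.

Definition bary_point (P Q R : point) (w : Z * Z * Z) : point :=
  let: (a, b, c) := w in
  (a * P.1 + b * Q.1 + c * R.1, a * P.2 + b * Q.2 + c * R.2)%Z.

(* The vertices [s], [t] of the units of one hub edge [uv] lie on a convex arc leading from
   [uv] towards the apex (weights of sum 256); [z] and [y] are the centroids of [ust] and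
   [vst], whence the common denominator 768. *)
Definition arc_weights (j : Z) : Z * Z * Z :=
  let h := (j * (13 - j) / 2)%Z in
  (8 * (14 - j) + h, 8 * (14 - j) - h, 16 * (j + 2))%Z.

Definition vertex_weights (i : Z) (r : nat) : Z * Z * Z :=
  let: (a, b, c) := arc_weights (2 * i)%Z in
  let: (a', b', c') := arc_weights (2 * i + 1)%Z in
  nth (0, 0, 0)%Z
    [:: (3 * a, 3 * b, 3 * c); (a + a' + 256, b + b', c + c'); (a + a', b + b' + 256, c + c');
        (3 * a', 3 * b', 3 * c')]%Z r.

Definition vertex_point (x : nat) : point :=
  if x < 4 then bary_point (hub_point x) (0, 0)%Z (0, 0)%Z (768, 0, 0)%Z
  else let k := (x %/ 4).-1 in let: (u, v) := unit_ends k in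
    bary_point (hub_point u) (hub_point v) (apex (k %/ 7))
      (vertex_weights (Z.of_nat (k %% 7)) (x %% 4)).

Definition segments : seq (point * point) :=
  [seq (vertex_point c.1, vertex_point c.2) | c <- edges].

Definition points : seq point := [seq vertex_point x | x <- iota 0 172].

Lemma segments_separated :
  pairwise (fun S S' => on_side S.1 S.2 S'.1 S'.2 || on_side S'.1 S'.2 S.1 S.2) segments.
Proof. by vm_compute. Qed.

Definition avoids (S : point * point) (X : point) : bool :=
  if Z.eqb (orient S.1 S.2 X) 0 then point_eqb X S.1 || point_eqb X S.2 else true.

Lemma points_off_segments : all (fun S => all (avoids S) points) segments.
Proof. by vm_compute. Qed.

Lemma points_distinct : pairwise (fun X Y => ~~ point_eqb X Y) points.
Proof. by vm_compute. Qed.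

Local Open Scope R_scope.

(** * Real segments and planarity *)

Definition real_point (P : point) : R * R := (IZR P.1, IZR P.2).

Definition segment (P Q : point) (t : R) : R * R :=
  ((1 - t) * IZR P.1 + t * IZR Q.1, (1 - t) * IZR P.2 + t * IZR Q.2).

Lemma segment_rev P Q t : segment P Q t = segment Q P (1 - t).
Proof. rewrite /segment; congr pair; ring. Qed.

Lemma real_point_inj : injective real_point.
Proof. by move=> [a b] [c d] [/eq_IZR-> /eq_IZR->]. Qed.

Lemma orient_R P Q X : IZR (orient P Q X) =
  (IZR Q.1 - IZR P.1) * (IZR X.2 - IZR P.2) - (IZR Q.2 - IZR P.2) * (IZR X.1 - IZR P.1).
Proof. by rewrite /orient !(minus_IZR, mult_IZR). Qed.

Lemma convex_comb_gt0 a b t :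
  0 <= a -> 0 <= b -> 0 < a + b -> 0 < t < 1 -> 0 < (1 - t) * a + t * b.
Proof.
move=> a0 b0 ab [t0 t1].
have [a1|{}a0] : 0 < a \/ a = 0 by lra.
  have := Rmult_lt_0_compat (1 - t) a; have := Rmult_le_pos t b; lra.
have := Rmult_lt_0_compat t b; rewrite a0 in ab *; lra.
Qed.

(** The map [orient P Q] is affine, hence of one strict sign in the interior of [XY], while it
    vanishes on the line [PQ]. *)
Lemma on_side_disjoint P Q X Y s t :
  on_side P Q X Y -> 0 < t < 1 -> segment P Q s <> segment X Y t.
Proof.
rewrite /on_side => side t01 [e1 e2].
have : (1 - t) * IZR (orient P Q X) + t * IZR (orient P Q Y) = 0.
  rewrite !orient_R.
  transitivity ((IZR Q.1 - IZR P.1) * ((1 - t) * IZR X.2 + t * IZR Y.2 - IZR P.2)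
    - (IZR Q.2 - IZR P.2) * ((1 - t) * IZR X.1 + t * IZR Y.1 - IZR P.1)); first by ring.
  by rewrite -e1 -e2; ring.
case/orP: side => /and3P[/Z.leb_le/IZR_le ha /Z.leb_le/IZR_le hb /Z.ltb_lt/IZR_lt];
  rewrite plus_IZR => hab h0.
- have := convex_comb_gt0 ha hb hab t01; lra.
- have := @convex_comb_gt0 (- IZR (orient P Q X)) (- IZR (orient P Q Y)) t; lra.
Qed.

Lemma segment_avoids P Q X t : orient P Q X <> 0%Z -> segment P Q t <> real_point X.
Proof.
move=> n [e1 e2]; apply: n; apply: eq_IZR; rewrite orient_R -e1 -e2; ring.
Qed.

Lemma segment_inj P Q s t : P <> Q -> segment P Q s = segment P Q t -> s = t.
Proof.
move=> n [e1 e2]; have [//|nst] := Req_dec s t; case: n; apply: real_point_inj.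
have {}nst : s - t <> 0 by lra.
rewrite /real_point; congr pair; apply: (Rmult_eq_reg_l (s - t)) => //; lra.
Qed.

Lemma segment0 P Q : segment P Q 0 = real_point P.
Proof. rewrite /segment /real_point; congr pair; ring. Qed.

Lemma segment1 P Q : segment P Q 1 = real_point Q.
Proof. rewrite /segment /real_point; congr pair; ring. Qed.

(** The difference is [(s - t) * (b - a)]; the summand 1 keeps the divisor positive when [a = b]. *)
Lemma affine_bound a b s t eps : 0 < eps -> Rabs (s - t) < eps / (1 + Rabs (b - a)) ->
  Rabs ((1 - s) * a + s * b - ((1 - t) * a + t * b)) < eps.
Proof.
move=> e0 h; have -> : (1 - s) * a + s * b - ((1 - t) * a + t * b) = (s - t) * (b - a) by ring.
rewrite Rabs_mult; have := Rabs_pos (b - a); have := Rabs_pos (s - t).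
move: h; move: (Rabs (s - t)) (Rabs (b - a)) => x y h x0 y0.
have : x * (1 + y) < eps.
  by apply: (Rmult_lt_reg_r (/ (1 + y))); [apply: Rinv_0_lt_compat; lra
    |rewrite Rmult_assoc Rinv_r; lra].
nra.
Qed.

Lemma segment_cont P Q : cont01 (segment P Q).
Proof.
move=> t _ eps e0.
exists (Rmin (eps / (1 + Rabs (IZR Q.1 - IZR P.1))) (eps / (1 + Rabs (IZR Q.2 - IZR P.2)))).
have pos y : 0 < eps / (1 + Rabs y).
  by apply: Rdiv_lt_0_compat => //; have := Rabs_pos y; lra.
split; first exact: Rmin_glb_lt.
by move=> s _ h; split; apply: affine_bound => //; apply: Rlt_le_trans h _;
  [apply: Rmin_l|apply: Rmin_r].
Qed.

Lemma pairwise_in (A : eqType) (r : rel A) (l : seq A) x y :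
  pairwise r l -> x \in l -> y \in l -> x != y -> r x y || r y x.
Proof.
elim: l => //= a l IH /andP[/allP al pl]; rewrite !inE.
case/predU1P=> [->|xl]; case/predU1P=> [->|yl] n; first by rewrite eqxx in n.
- by rewrite al.
- by rewrite al ?orbT.
- exact: IH.
Qed.

Lemma point_eqbP P Q : reflect (P = Q) (point_eqb P Q).
Proof.
case: P Q => [a b] [c d]; apply: (iffP andP) => /= [[/Z.eqb_eq-> /Z.eqb_eq->] //|[-> ->]].
by rewrite !Z.eqb_refl.
Qed.

Lemma vertex_point_inj (x y : nat) :
  (x < 172)%nat -> (y < 172)%nat -> vertex_point x = vertex_point y -> x = y.
Proof.
move=> hx hy e; apply/eqP; apply: contraT => n.
have h := points_distinct; rewrite /points pairwise_map in h.
have := @pairwise_in _ _ _ x y h; rewrite !mem_iota hx hy => /(_ isT isT n) /=.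
by rewrite e (introT (point_eqbP _ _) (erefl _)).
Qed.

Lemma edge_segments_disjoint a b c d s t : (a, b) \in edges -> (c, d) \in edges ->
  (a, b) != (c, d) -> 0 < s < 1 -> 0 < t < 1 ->
  segment (vertex_point a) (vertex_point b) s <> segment (vertex_point c) (vertex_point d) t.
Proof.
move=> ab cd n s01 t01.
have h := segments_separated; rewrite /segments pairwise_map in h.
have {h} := pairwise_in h ab cd n; rewrite /= [X in _ || X]orbC orbb.
by case/orP=> h; [|apply: nesym]; apply: (on_side_disjoint h).
Qed.

Lemma vertex_off_edge a b x t : (a, b) \in edges -> (x < 172)%nat -> 0 < t < 1 ->
  segment (vertex_point a) (vertex_point b) t <> real_point (vertex_point x).
Proof.
move=> ab hx t01; have /andP[/= lab hb] := allP edges_lt _ ab.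
have nP : vertex_point a <> vertex_point b.
  by move/vertex_point_inj; rewrite hb (ltn_trans lab hb) => /(_ isT isT) e; rewrite e ltnn in lab.
have h := points_off_segments; rewrite /segments all_map in h.
have {}h : all (avoids (vertex_point a, vertex_point b)) points := allP h _ ab.
rewrite /points all_map in h.
have : avoids (vertex_point a, vertex_point b) (vertex_point x).
  by apply: (allP h x); rewrite mem_iota.
rewrite /avoids [X in orient X]/= [X in orient _ X]/=.
case: Z.eqb_spec => [_|/segment_avoids n _]; last exact: n.
(* A vertex on the line of the edge is one of its ends, which the segment reaches only at parameter
   0 or 1. *)
case/orP=> /point_eqbP->.
- by rewrite -(segment0 _ (vertex_point b)) => /(segment_inj nP); lra.
- by rewrite -(segment1 (vertex_point a)) => /(segment_inj nP); lra.
Qed.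

Lemma G_planar : planar G_rel.
Proof.
exists (fun x : 'I_172 => real_point (vertex_point x)).
exists (fun (x y : 'I_172) t => segment (vertex_point x) (vertex_point y) t).
have flip (r : R) : 0 < r < 1 -> 0 < 1 - r < 1 by lra.
split; last split.
- move=> x y /real_point_inj /vertex_point_inj h; apply: val_inj; exact: h.
- move=> u v uv; split; first exact: segment_cont.
  split; first exact: segment0.
  split; first exact: segment1.
  split.
    move=> s t _ _; apply: segment_inj => /vertex_point_inj h.
    by move: (adj_neq G_irr uv) => /eqP; apply; apply: val_inj; apply: h; apply: ltn_ord.
  move=> t w t01; case/orP: uv => uv; first exact: vertex_off_edge.
  by rewrite segment_rev; apply: vertex_off_edge => //; apply: flip.
- move=> u v x y.
  (* The computed checks cover edges with the smaller end first; a reversed edge is the same segment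
     with parameter [1 - t]. *)
  wlog uv' : u v / (val u, val v) \in edges.
    move=> th uv; case/orP: (uv) => m; first exact: (th u v m uv).
    move=> xy n s t s01 t01; rewrite segment_rev.
    have vu : G_rel v u by rewrite G_sym.
    by apply: (th v u m vu xy _ _ _ (flip _ s01) t01); rewrite setUC.
  wlog xy' : x y / (val x, val y) \in edges.
    move=> th uv xy; case/orP: (xy) => m; first exact: (th x y m uv xy).
    move=> n s t s01 t01; rewrite [RHS]segment_rev.
    have yx : G_rel y x by rewrite G_sym.
    by apply: (th y x m uv yx _ _ _ s01 (flip _ t01)); rewrite [X in _ != X]setUC.
  move=> _ _ n s t s01 t01; apply: edge_segments_disjoint => //.
  by apply: contraNneq n => -[/val_inj-> /val_inj->].
Qed.

Local Close Scope R_scope.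

Theorem theorem2 :
  exists (T : finType) (e : rel T),
    simple_graph e /\ planar e /\ local_page_number_is e 3.
Proof.
exists 'I_172, G_rel; split; first by split; [apply: G_sym|apply: G_irr].
split; first exact: G_planar.
split; first exact: G_3_local.
(* A [j]-local embedding with [j < 3] is also 2-local. *)
move=> j j3 [p [pg [bk sz]]]; apply: G_not_2_local.
by exists p, pg; split=> // x; apply: leq_trans (sz x) _.
Qed.
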